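(* Let $\gamma:\mathcal T\to\mathbb R$ be continuous and positively homogeneous, and let $N(\gamma)$, $\mathcal L(\gamma)$, $\mathcal L_{\max}(\gamma)$, the core $\mathcal H_\kappa$ and the additivity space $\mathcal A(\gamma)$ be as defined in the context. (1) For $w\in\mathcal H_\kappa$ and $v\in N(\gamma)$, $\gamma$ is linear on $\operatorname{span}(v,w)$; in particular $\operatorname{span}(v,w)\subseteq N(\gamma)$. (2) $\mathcal H_\kappa$ is a closed linear subspace and a linearity subspace. (3) For every $V\in\mathcal L(\gamma)$, $V+\mathcal H_\kappa\in\mathcal L(\gamma)$. Consequently $\mathcal H_\kappa=\bigcap_{V\in\mathcal L_{\max}(\gamma)}V$. (4) $\mathcal A(\gamma)$ is a closed linearity subspace with $\mathcal A(\gamma)\subseteq\mathcal H_\kappa$, with equality whenever $N(\gamma)=\mathcal T$ (that is, $\gamma$ is odd). (5) $\gamma$ is linear on $\mathcal T$ if and only if $\mathcal H_\kappa=\mathcal T$.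
   Context: $\mathcal T$ is a linear subspace of the Hilbert space $L_2^0(P)$ of mean-zero square-integrable functions for a probability measure $P$, with the norm topology (''closed'' means closed in $\mathcal T$). $\gamma$ is positively homogeneous if $\gamma(ch)=c\gamma(h)$ for $c\ge0$. The odd cone is $N(\gamma):=\{h\in\mathcal T:\gamma(h)+\gamma(-h)=0\}$. A linear subspace $V\subseteq\mathcal T$ is a linearity subspace if $\gamma|_V$ is linear. $\mathcal L(\gamma)$ is the family of linearity subspaces and $\mathcal L_{\max}(\gamma)$ its set of maximal elements under inclusion. The core is $\mathcal H_\kappa:=\{w\in N(\gamma):\gamma(v+cw)=\gamma(v)+c\,\gamma(w)\ \forall v\in N(\gamma),\ c\in\mathbb R\}$. The additivity space is $\mathcal A(\gamma):=\{w\in\mathcal T:\gamma(h+w)=\gamma(h)+\gamma(w)\ \forall h\in\mathcal T\}$. *)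

(* Defs.v *)
From HB Require Import structures.
From mathcomp Require Import all_boot all_order all_algebra.
From mathcomp Require Import all_classical all_reals all_analysis.
From mathcomp Require Import measurable_realfun ess_sup_inf.

Set Implicit Arguments.
Unset Strict Implicit.
Unset Printing Implicit Defensive.

Import Order.TTheory GRing.Theory Num.Theory.
Import numFieldNormedType.Exports.

Local Open Scope classical_set_scope.
Local Open Scope ring_scope.

(* The library's type LspaceType mu p1 of classes of p-integrable functions modulo
   almost-everywhere equality carries no algebraic structure; it is made here into
   a normed module for the pointwise operations and the norm 'N[mu]_p. *)
Section Lspace_normedModType.
Context d (T : measurableType d) (R : realType).
Variables (mu : {measure set T -> \bar R}) (p : \bar R) (p1 : (1 <= p)%E).

Local Notation Lf := (LfunType mu p1).
Local Notation Ls := (LspaceType mu p1).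

Lemma ae_eq_Lnorm (f g : T -> R) :
  measurable_fun setT f -> measurable_fun setT g -> f = g %[ae mu] ->
  ('N[mu]_p[EFin \o f] = 'N[mu]_p[EFin \o g])%E.
Proof.
move=> mf mg fg; rewrite unlock.
have mN (r : R) (h : T -> R) : measurable_fun setT h ->
    measurable_fun setT ((fun x => `|(EFin \o h) x| `^ r)%E : T -> \bar R).
  move=> mh; apply: (measurableT_comp (measurable_poweR r)).
  by apply: measurableT_comp => //; exact/measurable_EFinP.
case: p p1 => [r r1||//].
- congr (_ `^ _)%E; apply: ae_eq_integral => //; [exact: mN|exact: mN|].
  by apply: filterS fg => x /= + xT => /(_ xT) ->.
- move=> _; case: ifP => // _; apply: eq_ess_sup.
  by apply: filterS fg => x /= /(_ I) ->.
Qed.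

Definition Lspace_fun (u : Ls) : T -> R := (u : {mfun_ mu, T >-> _}).

Lemma Lspace_funP (u : Ls) : Lspace_fun u \in Lfun mu p.
Proof.
apply/andP; split; rewrite inE /=.
  exact: (@measurable_funPT _ _ T _ (repr (LebesgueSpace.sort u))).
exact: (@Lebesgue_finite _ _ _ _ _ p1 u).
Qed.

Definition Lfun_of_Lspace (u : Ls) : Lf := Lfun_Sub p1 (Lspace_funP u).

(* The measurable sets of R and measurableTypeR R coincide, but their displays
   differ, so the two types of measurable functions are not convertible. *)
Let mR (f : Lf) : @measurable_fun _ _ T (measurableTypeR R) setT f.
Proof. exact: (@measurable_funPT _ _ _ _ f). Qed.

Let mfunR (f : Lf) : {mfun T >-> measurableTypeR R} :=
  @mfun_Sub _ _ T (measurableTypeR R) f (mem_set (mR f)).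

Definition pi_Lfun (f : Lf) : {mfun_ mu, T >-> measurableTypeR R} :=
  \pi_({mfun_ mu, T >-> measurableTypeR R})%qT (mfunR f).

Lemma repr_pi_Lfun (f : Lf) : (repr (pi_Lfun f) : T -> R) = f %[ae mu].
Proof.
have : ae_eq_op mu (repr (pi_Lfun f)) (mfunR f) by apply/eqmodP; rewrite reprK.
by move=> /asboolP.
Qed.

Let pi_Lfun_finite (f : Lf) : finite_norm mu p (pi_Lfun f).
Proof.
rewrite /finite_norm (_ : 'N[mu]_p[_] = 'N[mu]_p[EFin \o f])%E.
  exact: Lfunction_finite.
apply: ae_eq_Lnorm; [|exact: mR|exact: repr_pi_Lfun].
exact: (@measurable_funPT _ _ _ _ (repr (pi_Lfun f))).
Qed.

Definition Lspace_of_Lfun (f : Lf) : Ls :=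
  LebesgueSpace.Pack (LebesgueSpace.Class
    (isFinLebesgue.Build _ _ _ mu p p1 (pi_Lfun f) (pi_Lfun_finite f))).

Lemma Lspace_of_LfunK (f : Lf) :
  (Lfun_of_Lspace (Lspace_of_Lfun f) : T -> R) = f %[ae mu].
Proof. exact: repr_pi_Lfun. Qed.

Lemma eq_Lspace (u v : Ls) : Lspace_fun u = Lspace_fun v %[ae mu] -> u = v.
Proof.
move=> uv.
have : LebesgueSpace.sort u = LebesgueSpace.sort v.
  rewrite -(reprK (LebesgueSpace.sort u)) -(reprK (LebesgueSpace.sort v)).
  by apply/eqmodP/asboolP.
case: u v {uv} => [u [[uf]]] [v [[vf]]] /= uv; subst v.
by rewrite (Prop_irrelevance uf vf).
Qed.

Lemma eq_Lspace_of_Lfun (f g : Lf) :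
  (f : T -> R) = g %[ae mu] -> Lspace_of_Lfun f = Lspace_of_Lfun g.
Proof.
move=> fg; apply: eq_Lspace; apply: ae_eq_trans (Lspace_of_LfunK f) _.
exact: ae_eq_trans fg (ae_eq_sym (Lspace_of_LfunK g)).
Qed.

Lemma Lfun_of_LspaceK : cancel Lfun_of_Lspace Lspace_of_Lfun.
Proof. by move=> u; apply: eq_Lspace; exact: Lspace_of_LfunK. Qed.

HB.instance Definition _ := gen_eqMixin Ls.
HB.instance Definition _ := gen_choiceMixin Ls.

Definition Lspace_zero : Ls := Lspace_of_Lfun 0.
Definition Lspace_opp (u : Ls) : Ls := Lspace_of_Lfun (- Lfun_of_Lspace u).
Definition Lspace_add (u v : Ls) : Ls :=
  Lspace_of_Lfun (Lfun_of_Lspace u + Lfun_of_Lspace v).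
Definition Lspace_scale (a : R) (u : Ls) : Ls :=
  Lspace_of_Lfun (a *: Lfun_of_Lspace u).

Lemma Lspace_of_LfunD (f g : Lf) :
  Lspace_of_Lfun (f + g) = Lspace_add (Lspace_of_Lfun f) (Lspace_of_Lfun g).
Proof.
apply: eq_Lspace_of_Lfun.
have := Lspace_of_LfunK f; have := Lspace_of_LfunK g.
apply: filterS2 => x gx fx xT.
exact: (esym (congr2 +%R (fx xT) (gx xT))).
Qed.

Lemma Lspace_of_LfunZ (a : R) (f : Lf) :
  Lspace_of_Lfun (a *: f) = Lspace_scale a (Lspace_of_Lfun f).
Proof.
apply: eq_Lspace_of_Lfun; have := Lspace_of_LfunK f.
apply: filterS => x fx xT.
exact: (esym (congr1 (fun y => a * y) (fx xT))).
Qed.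

Let addA : associative Lspace_add.
Proof.
move=> u v w; rewrite -[u]Lfun_of_LspaceK -[v]Lfun_of_LspaceK.
by rewrite -[w]Lfun_of_LspaceK -!Lspace_of_LfunD addrA.
Qed.

Let addC : commutative Lspace_add.
Proof. by move=> u v; rewrite /Lspace_add addrC. Qed.

Let add0 : left_id Lspace_zero Lspace_add.
Proof. by move=> u; rewrite -[u]Lfun_of_LspaceK -Lspace_of_LfunD add0r. Qed.

Let addN : left_inverse Lspace_zero Lspace_opp Lspace_add.
Proof.
move=> u; rewrite -[X in Lspace_add _ X]Lfun_of_LspaceK.
by rewrite -Lspace_of_LfunD addNr.
Qed.

HB.instance Definition _ := GRing.isZmodule.Build Ls addA addC add0 addN.

Let scaleA (a b : R) (u : Ls) :
  Lspace_scale a (Lspace_scale b u) = Lspace_scale (a * b) u.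
Proof.
by rewrite -[u]Lfun_of_LspaceK -!Lspace_of_LfunZ scalerA.
Qed.

Let scale1 : left_id 1 Lspace_scale.
Proof. by move=> u; rewrite -[u]Lfun_of_LspaceK -Lspace_of_LfunZ scale1r. Qed.

Let scaleDr : right_distributive Lspace_scale +%R.
Proof.
move=> a u v; rewrite -[u]Lfun_of_LspaceK -[v]Lfun_of_LspaceK.
rewrite -[_ + _]Lspace_of_LfunD -!Lspace_of_LfunZ -[RHS]Lspace_of_LfunD.
by rewrite scalerDr.
Qed.

Let scaleDl (u : Ls) : {morph Lspace_scale^~ u : a b / a + b}.
Proof.
move=> a b; rewrite -[u]Lfun_of_LspaceK -!Lspace_of_LfunZ.
by rewrite -[RHS]Lspace_of_LfunD scalerDl.
Qed.

HB.instance Definition _ :=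
  GRing.Zmodule_isLmodule.Build R Ls scaleA scale1 scaleDr scaleDl.

Definition Lspace_norm (u : Ls) : R := fine ('N[mu]_p[EFin \o Lspace_fun u])%E.

Lemma Lspace_normE (f : Lf) :
  Lspace_norm (Lspace_of_Lfun f) = fine ('N[mu]_p[EFin \o f])%E.
Proof.
congr fine; apply: ae_eq_Lnorm; [|exact: mR|exact: Lspace_of_LfunK].
exact: (@measurable_funPT _ _ _ _ (Lfun_of_Lspace (Lspace_of_Lfun f))).
Qed.

Let normD (u v : Ls) : Lspace_norm (u + v) <= Lspace_norm u + Lspace_norm v.
Proof.
by rewrite -[u + v]/(Lspace_of_Lfun _) Lspace_normE; exact: ler_LnormD.
Qed.

Let normZ (a : R) (u : Ls) : Lspace_norm (a *: u) = `|a| * Lspace_norm u.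
Proof.
rewrite -[a *: u]/(Lspace_of_Lfun _) Lspace_normE.
have /= -> := LnormZ (Lfun_of_Lspace u) a.
by rewrite -(finite_norm_fine (Lfun_of_Lspace u)).
Qed.

Let norm0 (u : Ls) : Lspace_norm u = 0 -> u = 0.
Proof.
move=> /(@fine_Lnormr_eq0 _ _ _ _ _ p1 (Lfun_of_Lspace u)) u0.
rewrite -[u]Lfun_of_LspaceK; exact: eq_Lspace_of_Lfun.
Qed.

HB.instance Definition _ := Lmodule_isNormed.Build R Ls normD normZ norm0.

End Lspace_normedModType.

(* The Hilbert space L_2(P) of square-integrable functions modulo P-almost sure
   equality, with the topology of the norm 'N[P]_2. *)
Notation L2 P := (LspaceType P (lee1n 2)).

Section mean_zero.
Context d (Omega : measurableType d) (R : realType) (P : probability Omega R).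

Definition L20 : set (L2 P) := [set h : L2 P | ('E_P[h] = 0)%E].

End mean_zero.
Arguments L20 {d Omega R} P.

(* A function gamma on the subspace T is represented by a total function on the
   ambient space E whose values outside T play no role: every notion below only
   evaluates gamma on T when T is a linear subspace. *)
Section odd_cone.
Context (R : realType) (E : normedModType R).
Implicit Types (T V W A : set E) (gamma : E -> R).

Definition linear_subspace V := submod_closed (mem V : {pred E}).

(* For A `<=` T, this is closedness of A in the topology induced on T. *)
Definition closed_in T A := @closed (subspace T) A.

Definition positively_homogeneous T gamma :=
  forall (c : R) (h : E), 0 <= c -> T h -> gamma (c *: h) = c * gamma h.

Definition linear_on V gamma :=
  forall (a : R) (x y : E), V x -> V y ->
    gamma (a *: x + y) = a * gamma x + gamma y.

Definition span2 (v w : E) : set E :=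
  [set x | exists a b : R, x = a *: v + b *: w].

Definition set_add V W : set E := [set v + w | v in V & w in W].

Definition odd_cone T gamma : set E :=
  [set h | T h /\ gamma h + gamma (- h) = 0].

Definition linearity_subspaces T gamma : set (set E) :=
  [set V | [/\ linear_subspace V, V `<=` T & linear_on V gamma]].

Definition maximal_linearity_subspaces T gamma : set (set E) :=
  [set V | linearity_subspaces T gamma V /\
           forall W, linearity_subspaces T gamma W -> V `<=` W -> W = V].

Definition core T gamma : set E :=
  [set w | odd_cone T gamma w /\
           forall (v : E) (c : R), odd_cone T gamma v ->
             gamma (v + c *: w) = gamma v + c * gamma w].

Definition additivity_space T gamma : set E :=
  [set w | T w /\ forall h, T h -> gamma (h + w) = gamma h + gamma w].

End odd_cone.

(* Main.v *)
(* [gamma] is real-homogeneous on the odd cone [N], so a core element [w] satisfies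
   [gamma (a v + b w) = a gamma v + b gamma w] for every [v] in [N]; applied to
   [- (a v + b w)], this keeps [a v + b w] in [N]. Hence the core can be added to
   any linearity subspace, and so lies in every maximal one; conversely each [v]
   in [N] spans a linearity line, which Zorn's lemma places in a maximal linearity
   subspace, and this contains any [w] common to all maximal ones. *)
Require Import Defs.
From HB Require Import structures.
From mathcomp Require Import all_boot all_order all_algebra.
From mathcomp Require Import all_classical all_reals all_analysis.
From mathcomp Require Import measurable_realfun.
From mathcomp Require Import ring.

Set Implicit Arguments.
Unset Strict Implicit.
Unset Printing Implicit Defensive.

Import Order.TTheory GRing.Theory Num.Theory.
Import numFieldNormedType.Exports.

Local Open Scope classical_set_scope.
Local Open Scope ring_scope.

(** * Linear subspaces and relatively closed sets *)

Section linear_subspace_theory.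
Context (R : realType) (E : normedModType R).
Implicit Types (V W T : set E) (gamma : E -> R).

Lemma linear_subspaceP V : linear_subspace V <->
  V 0 /\ (forall (a : R) u v, V u -> V v -> V (a *: u + v)).
Proof.
split=> [[V0 VD]|[V0 VD]]; split.
- by move: V0; rewrite inE.
- by move=> a u v Vu Vv; have := VD a u v; rewrite !inE; apply.
- by rewrite inE.
- by move=> a u v; rewrite !inE; exact: VD.
Qed.

Section closure_properties.
Context V (subV : linear_subspace V).

Lemma subspace0 : V 0.
Proof. by case/linear_subspaceP: subV. Qed.

Lemma subspaceZD (a : R) u v : V u -> V v -> V (a *: u + v).
Proof. by case/linear_subspaceP: subV => _; apply. Qed.

Lemma subspaceZ (a : R) u : V u -> V (a *: u).
Proof. by move=> Vu; rewrite -[_ *: _]addr0; exact: subspaceZD subspace0. Qed.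

Lemma subspaceD u v : V u -> V v -> V (u + v).
Proof. by rewrite -{2}[u]scale1r; exact: subspaceZD. Qed.

Lemma subspaceN u : V u -> V (- u).
Proof. by rewrite -scaleN1r; exact: subspaceZ. Qed.

End closure_properties.

Lemma linear_subspace_add V W :
  linear_subspace V -> linear_subspace W -> linear_subspace (set_add V W).
Proof.
move=> sV sW; apply/linear_subspaceP; split.
  by exists 0; [exact: subspace0|exists 0; rewrite ?addr0//; exact: subspace0].
move=> a _ _ [v1 Vv1 [w1 Ww1 <-]] [v2 Vv2 [w2 Ww2 <-]].
exists (a *: v1 + v2); first exact: subspaceZD.
exists (a *: w1 + w2); first exact: subspaceZD.
by rewrite scalerDr addrACA.
Qed.

Lemma subset_set_addl V W : W 0 -> V `<=` set_add V W.
Proof. by move=> W0 v Vv; exists v => //; exists 0; rewrite ?addr0. Qed.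

Lemma subset_set_addr V W : V 0 -> W `<=` set_add V W.
Proof. by move=> V0 w Ww; exists 0 => //; exists w; rewrite ?add0r. Qed.

Lemma linear_subspace_span2 (v w : E) : linear_subspace (span2 v w).
Proof.
apply/linear_subspaceP; split; first by exists 0, 0; rewrite !scale0r addr0.
move=> a _ _ [b1 [c1 ->]] [b2 [c2 ->]]; exists (a * b1 + b2), (a * c1 + c2).
by rewrite scalerDr !scalerDl !scalerA addrACA.
Qed.

(** The set is an intersection of preimages of the closed set [[set 0]] under the maps [f i - g i],
    which are continuous on [T]. Both the core and the additivity space have this form. *)
Lemma closed_in_equalizer T I (D : set I) (f g : I -> E -> R) :
  (forall i, D i -> {within T, continuous (f i)}) ->
  (forall i, D i -> {within T, continuous (g i)}) ->
  closed_in T [set w | T w /\ forall i, D i -> f i w = g i w].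
Proof.
move=> cf cg; rewrite /closed_in.
rewrite (_ : [set _ | _] =
    T `&` \bigcap_(i in D) ((fun w => f i w - g i w) @^-1` [set 0])); last first.
  apply/seteqP; split=> w [Tw fg]; split=> // i Di.
    by rewrite /= fg// subrr.
  by have /= /eqP := fg i Di; rewrite subr_eq0 => /eqP.
apply: closedI; first exact: closed_subspaceT.
apply: closed_bigI => i Di.
suff : {within T, continuous (fun w => f i w - g i w)}.
  by move/continuous_closedP; apply; exact: closed_eq.
by move=> x; apply: cvgB; [exact: cf|exact: cg].
Qed.

(** The affine map [w |-> v + c *: w] is continuous and sends [T] into itself, so composing with it
    only requires continuity of [gamma] relative to [T]. *)
Lemma within_continuous_affine T gamma v (c : R) :
  linear_subspace T -> T v -> {within T, continuous gamma} ->
  {within T, continuous (fun w => gamma (v + c *: w))}.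
Proof.
move=> sT Tv /subspace_continuousP cgamma; apply/subspace_continuousP => x Tx.
have Tvx w : T w -> T (v + c *: w).
  by move=> Tw; apply: subspaceD => //; exact: subspaceZ.
have cvx : (fun w => v + c *: w) @ nbhs x --> v + c *: x.
  by apply: cvgD; [exact: cvg_cst|apply: cvgZl_tmp; exact: cvg_id].
apply: cvg_trans (cgamma _ (Tvx _ Tx)) => U /cvx.
by apply: (@filterS _ (nbhs x)) => w TU Tw; exact/TU/Tvx.
Qed.

End linear_subspace_theory.

Section odd_cone_theory.
Context (R : realType) (E : normedModType R) (T : set E) (gamma : E -> R).
Context (T_subspace : linear_subspace T)
  (gamma_homogeneous : positively_homogeneous T gamma).
Implicit Types (V W : set E).

Local Notation N := (odd_cone T gamma).
Local Notation L := (linearity_subspaces T gamma).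
Local Notation Lmax := (maximal_linearity_subspaces T gamma).
Local Notation H := (core T gamma).
Local Notation A := (additivity_space T gamma).

(** * Homogeneity on the odd cone *)

Lemma positively_homogeneous0 : gamma 0 = 0.
Proof.
rewrite -[X in gamma X](scale0r 0) gamma_homogeneous ?mul0r//.
exact: subspace0.
Qed.

Lemma odd_cone_oppE h : N h -> gamma (- h) = - gamma h.
Proof. by case=> _ /eqP; rewrite addrC addr_eq0 => /eqP. Qed.

Lemma odd_coneN h : N h -> N (- h).
Proof.
by case=> Th Nh; split; [exact: subspaceN|rewrite opprK addrC].
Qed.

Lemma odd_cone_scaleE h (c : R) : N h -> gamma (c *: h) = c * gamma h.
Proof.
move=> Nh; have [c0|/ltW c0] := leP 0 c.
  by rewrite gamma_homogeneous//; case: Nh.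
(* For [c < 0], [c *: h] is the nonnegative multiple [- c] of [- h], and oddness at [h] then
   restores the sign. *)
rewrite -[c *: h]opprK -scalerN -scaleNr gamma_homogeneous ?oppr_ge0//.
  by rewrite odd_cone_oppE// mulrNN.
by case: (odd_coneN Nh).
Qed.

Lemma odd_coneZ h (c : R) : N h -> N (c *: h).
Proof.
move=> Nh; split; first by case: Nh => Th _; exact: subspaceZ.
by rewrite -scaleNr !odd_cone_scaleE// mulNr subrr.
Qed.

Lemma odd_cone0 : N 0.
Proof.
by split; [exact: subspace0|rewrite oppr0 positively_homogeneous0 addr0].
Qed.

Lemma linear_on_scale V (a : R) x : linear_subspace V ->
  linear_on V gamma -> V x -> gamma (a *: x) = a * gamma x.
Proof.
move=> sV lV Vx; rewrite -[a *: x]addr0 lV//; last exact: subspace0.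
by rewrite positively_homogeneous0 addr0.
Qed.

Lemma linearity_subspace_odd V : L V -> V `<=` N.
Proof.
move=> [sV VT lV] x Vx; split; first exact: VT.
by rewrite -scaleN1r (linear_on_scale _ sV lV)// mulN1r subrr.
Qed.

(** * Algebra of the core *)

Lemma core_odd : H `<=` N.
Proof. by move=> w []. Qed.

Lemma core_combE w v (a b : R) : H w -> N v ->
  gamma (a *: v + b *: w) = a * gamma v + b * gamma w.
Proof.
by move=> [_ Hw] Nv; rewrite Hw ?odd_cone_scaleE//; exact: odd_coneZ.
Qed.

Lemma odd_coneD w v : H w -> N v -> N (v + w).
Proof.
move=> Hw Nv; split.
  by apply: subspaceD => //; [case: Nv|case: (core_odd Hw)].
(* The values at [v + w] and at [- v - w] are both additive, hence opposite. *)
have := core_combE 1 1 Hw Nv; have := core_combE (-1) (-1) Hw Nv.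
by rewrite !scale1r !scaleN1r opprD => -> ->; ring.
Qed.

Lemma coreZ w (c : R) : H w -> H (c *: w).
Proof.
move=> Hw; split; first exact/odd_coneZ/core_odd.
move=> v b Nv; rewrite scalerA odd_cone_scaleE; last exact: core_odd.
by case: Hw => _ ->//; rewrite mulrA.
Qed.

Lemma span2_core w v : H w -> N v ->
  linear_on (span2 v w) gamma /\ span2 v w `<=` N.
Proof.
move=> Hw Nv; split=> [a _ _ [b1 [c1 ->]] [b2 [c2 ->]]|_ [a [b ->]]].
  rewrite scalerDr addrACA !scalerA -!scalerDl !core_combE//; ring.
by apply: odd_coneD; [exact: coreZ|exact: odd_coneZ].
Qed.

Lemma linear_subspace_core : linear_subspace H.
Proof.
apply/linear_subspaceP; split.
  split; first exact: odd_cone0.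
  by move=> v c _; rewrite scaler0 positively_homogeneous0 mulr0 !addr0.
move=> a u v Hu Hv; split.
  by rewrite addrC; apply: odd_coneD; [exact: coreZ|exact: core_odd].
move=> x c Nx; rewrite [a *: u + v]addrC scalerDr addrA scalerA.
(* The multiple of [u] is split off first, at the base point [x + c *: v]. This point is in [N]
   because [v] is in the core, and the core property of [v] then splits it in turn. *)
have Ncv : N (c *: v) by exact/odd_coneZ/core_odd.
case: (Hu) => _ Huc; rewrite !Huc; [|exact: core_odd|].
  by case: Hv => _ ->//; ring.
by apply: odd_coneD => //; exact: coreZ.
Qed.

(** Since [V] lies in the odd cone, [gamma (v + w)] splits for [v] in [V] and [w] in the core.
    Linearity then holds separately on the two summands, on the second by the core condition at
    another core element. *)
Lemma linearity_subspace_add_core V : L V -> L (set_add V H).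
Proof.
move=> LV; have VN := linearity_subspace_odd LV; case: LV => sV VT lV.
split; first exact: linear_subspace_add linear_subspace_core.
  move=> _ [v Vv [w Hw <-]].
  by apply: subspaceD => //; [exact: VT|case: (core_odd Hw)].
have addE v w : V v -> H w -> gamma (v + w) = gamma v + gamma w.
  move=> /VN Nv Hw.
  by have := core_combE 1 1 Hw Nv; rewrite !scale1r !mul1r.
move=> a _ _ [v1 Vv1 [w1 Hw1 <-]] [v2 Vv2 [w2 Hw2 <-]].
have Vv : V (a *: v1 + v2) by exact: subspaceZD.
have Hw : H (a *: w1 + w2) by exact: (subspaceZD linear_subspace_core).
rewrite scalerDr addrACA (addE _ _ Vv Hw) (addE _ _ Vv1 Hw1) (addE _ _ Vv2 Hw2).
rewrite lV// [a *: w1 + _]addrC.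
case: (Hw1) => _ ->; last exact: core_odd.
ring.
Qed.

(** * Linearity subspaces and their maximal elements *)

Lemma linearity_subspace0 : L [set 0].
Proof.
split.
- by apply/linear_subspaceP; split=> // a _ _ -> ->; rewrite scaler0 addr0.
- by move=> _ ->; exact: subspace0.
- move=> a _ _ -> ->.
  by rewrite scaler0 addr0 positively_homogeneous0 mulr0 addr0.
Qed.

(** This is the sum with the core in the case of the zero subspace. *)
Lemma core_linearity : L H.
Proof.
have := linearity_subspace_add_core linearity_subspace0.
congr L; apply/seteqP; split; last exact: subset_set_addr.
by move=> _ [_ -> [w Hw <-]]; rewrite add0r.
Qed.

(** The line through [h] is written as a span with [0], which belongs to the core, so that
    [span2_core] applies. *)
Lemma linearity_subspace_line h : N h -> L (span2 h 0).
Proof.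
by move=> Nh; have [l s] := span2_core (subspace0 linear_subspace_core) Nh;
  split=> //; [exact: linear_subspace_span2|move=> x /s []].
Qed.

(* Zorn is applied to the sets [W] such that [V `|` W] is a linearity subspace,
   because the union of the empty chain, [set0], is not a subspace. *)
Lemma maximal_linearity_subspace_exists V : L V -> exists2 W, Lmax W & V `<=` W.
Proof.
move=> LV; have [F FP totF|W [LW Wmax]] := @Zorn_bigcup E [set W | L (V `|` W)].
  (* Each linearity condition involves at most two points, so it passes to the union once any two
     points share a member of the chain. *)
  have pairF x y : (V `|` \bigcup_(X in F) X) x ->
      (V `|` \bigcup_(X in F) X) y ->
      exists X, [/\ L (V `|` X), V `|` X `<=` V `|` \bigcup_(X in F) X,
                    (V `|` X) x & (V `|` X) y].
    have subF X : F X -> V `|` X `<=` V `|` \bigcup_(X in F) X.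
      by move=> FX; apply: setUS => z Xz; exists X.
    move=> [Vx|[X FX Xx]] [Vy|[Y FY Yy]].
    (* The chain may be empty here, so the witness is [set0], for which the union is [V] itself. *)
    - by exists set0; rewrite setU0; split=> //; exact: subsetUl.
    - by exists Y; split; [exact: FP|exact: subF|left|right].
    - by exists X; split; [exact: FP|exact: subF|right|left].
    - have [XY|YX] := totF _ _ FX FY.
        by exists Y; split; [exact: FP|exact: subF|right; exact: XY|right].
      by exists X; split; [exact: FP|exact: subF|right|right; exact: YX].
  split.
  - apply/linear_subspaceP; split; first by left; case: LV => /subspace0.
    move=> a x y Fx Fy; have [X [[sX _ _] XF Xx Xy]] := pairF _ _ Fx Fy.
    by apply: XF; exact: subspaceZD.
  - by move=> x Fx; have [X [[_ XT _] _ Xx _]] := pairF _ _ Fx Fx; exact: XT.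
  - move=> a x y Fx Fy; have [X [[_ _ lX] _ Xx Xy]] := pairF _ _ Fx Fy.
    exact: lX.
exists (V `|` W); last exact: subsetUl.
split=> // W' LW' VWW'; apply/seteqP; split=> //.
(* Otherwise [W'] strictly contains [W], while its union with [V] is [W'] itself, against the
   maximality of [W]. *)
apply: contrapT => W'VW; apply: (Wmax W').
  split; first by move=> x Wx; apply: VWW'; right.
  by move=> W'W; apply: W'VW => x /W'W; right.
rewrite /= (_ : V `|` W' = W')//; apply/setUidPr => x Vx.
by apply: VWW'; left.
Qed.

Lemma core_bigcap_maximal : H = \bigcap_(V in Lmax) V.
Proof.
apply/seteqP; split=> [w Hw V [LV Vmax]|w capw].
  (* Maximality forces [set_add V H = V]. *)
  rewrite -(Vmax _ (linearity_subspace_add_core LV)).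
    by apply: subset_set_addr => //; case: LV => /subspace0.
  exact/subset_set_addl/(subspace0 linear_subspace_core).
split.
  (* Starting from the zero subspace shows that the intersection is not over an empty family. *)
  have [V VLmax _] := maximal_linearity_subspace_exists linearity_subspace0.
  by apply: (linearity_subspace_odd (proj1 VLmax)); exact: capw.
move=> v c Nv.
have [V VLmax vV] :=
  maximal_linearity_subspace_exists (linearity_subspace_line Nv).
have Vv : V v by apply: vV; exists 1, 0; rewrite scale1r scale0r addr0.
case: (VLmax) => -[_ _ lV] _.
by rewrite addrC lV//; [rewrite addrC|exact: capw].
Qed.

(** * The additivity space and global linearity *)

Lemma additivity_space_odd : A `<=` N.
Proof.
move=> w [Tw Aw]; split=> //.
have := Aw _ (subspaceN T_subspace Tw).
by rewrite addNr positively_homogeneous0 addrC => <-.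
Qed.

Lemma additivity_spaceZ w (c : R) : A w -> A (c *: w).
Proof.
move=> Aw; have Nw := additivity_space_odd Aw; case: (Aw) => Tw AwE.
split=> [|h Th]; first exact: subspaceZ.
(* For [b > 0], factor [k + b *: w] as [b *: (b^-1 *: k + w)] and use homogeneity on both sides of
   additivity. *)
have posE b k : 0 < b -> T k -> gamma (k + b *: w) = gamma k + b * gamma w.
  move=> b0 Tk; rewrite -[k in LHS](scalerKV (lt0r_neq0 b0)) -scalerDr.
  rewrite gamma_homogeneous ?(ltW b0)//; last first.
    by apply: subspaceD => //; exact: subspaceZ.
  rewrite AwE; last exact: subspaceZ.
  rewrite gamma_homogeneous ?invr_ge0 ?(ltW b0)//; field; exact: lt0r_neq0.
rewrite odd_cone_scaleE//.
have [c0|c0|<-] := ltgtP 0 c; first exact: posE.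
  have cN0 : 0 < - c by rewrite oppr_gt0.
  (* For [c < 0], adding the positive multiple [- c] of [w] to [h + c *: w] gives back [h]. *)
  have := @posE _ (h + c *: w) cN0; rewrite scaleNr addrK => -> //.
    by ring.
  by apply: subspaceD => //; exact: subspaceZ.
by rewrite scale0r mul0r !addr0.
Qed.

Lemma additivity_spaceD u v : A u -> A v -> A (u + v).
Proof.
move=> [Tu Au] [Tv Av]; split=> [|h Th]; first exact: subspaceD.
by rewrite addrA !Av ?Au ?addrA//; exact: subspaceD.
Qed.

Lemma linear_subspace_additivity : linear_subspace A.
Proof.
apply/linear_subspaceP; split.
  split=> [|h _]; first exact: subspace0.
  by rewrite addr0 positively_homogeneous0 addr0.
by move=> a u v Au Av; apply: additivity_spaceD => //; exact: additivity_spaceZ.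
Qed.

Lemma additivity_linearity : L A.
Proof.
split; [exact: linear_subspace_additivity|by move=> w []|].
move=> a x y Ax [Ty ->]; last by case: (additivity_spaceZ a Ax).
by rewrite odd_cone_scaleE//; exact: additivity_space_odd.
Qed.

Lemma additivity_sub_core : A `<=` H.
Proof.
move=> w Aw; have Nw := additivity_space_odd Aw.
split=> // v c [Tv _]; have [_ ->//] := additivity_spaceZ c Aw.
by rewrite odd_cone_scaleE.
Qed.

Lemma additivity_core_odd : N = T -> A = H.
Proof.
move=> NT; apply/seteqP; split=> [|w [[Tw _] Hw]].
  exact: additivity_sub_core.
split=> // h; rewrite -NT => Nh.
by have := Hw h 1 Nh; rewrite scale1r mul1r.
Qed.

Lemma linear_on_core : linear_on T gamma <-> H = T.
Proof.
split=> [lT|<-]; last by case: core_linearity.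
have LT : L T by split.
apply/seteqP; split=> [w [[]]//|w Tw]; split.
  exact: linearity_subspace_odd LT w Tw.
by move=> v c [Tv _]; rewrite addrC lT// addrC.
Qed.

(** * Closedness in [T] *)

Lemma closed_core : {within T, continuous gamma} -> closed_in T H.
Proof.
move=> cgamma.
(* The core is recast as a family of equations in [w] indexed by the pairs [(v, c)], each with both
   sides continuous on [T]. *)
rewrite (_ : H = [set w | T w /\ forall vc : E * R, N vc.1 ->
    gamma (vc.1 + vc.2 *: w) = gamma vc.1 + vc.2 * gamma w]); last first.
  apply/seteqP; split=> [w [[Tw _] Hw]|w [Tw Hw]].
    by split=> // -[v c] Nv; exact: Hw.
  (* The additivity condition at [v = 0] and [c = -1] already forces [w] to be
     odd, so membership in the odd cone is not a separate closed condition. *)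
  split; last by move=> v c Nv; exact: (Hw (v, c)).
  split=> //; have /= := Hw (0, -1) odd_cone0.
  by rewrite positively_homogeneous0 !add0r scaleN1r mulN1r => ->; rewrite subrr.
apply: closed_in_equalizer.
- by move=> [v c] [Tv _]; exact: within_continuous_affine.
- move=> [v c] _ x; apply: cvgD; first exact: cvg_cst.
  by apply: cvgMl_tmp; exact: cgamma.
Qed.

Lemma closed_additivity_space : {within T, continuous gamma} -> closed_in T A.
Proof.
move=> cgamma; apply: closed_in_equalizer => h Th.
  have := within_continuous_affine (c := 1) T_subspace Th cgamma.
  by under eq_fun do rewrite scale1r.
by move=> x; apply: cvgD; [exact: cvg_cst|exact: cgamma].
Qed.

End odd_cone_theory.

Theorem theorem2 (d : measure_display) (Omega : measurableType d) (R : realType)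
    (P : probability Omega R) (T : set (L2 P)) (gamma : L2 P -> R)
    (T_subspace : linear_subspace T)
    (T_mean_zero : T `<=` L20 P)
    (gamma_continuous : {within T, continuous gamma})
    (gamma_homogeneous : positively_homogeneous T gamma) :
  let N := odd_cone T gamma in
  let L := linearity_subspaces T gamma in
  let Lmax := maximal_linearity_subspaces T gamma in
  let H := core T gamma in
  let A := additivity_space T gamma in
  [/\ (forall w v, H w -> N v ->
         linear_on (span2 v w) gamma /\ span2 v w `<=` N),
      [/\ linear_subspace H, closed_in T H & L H],
      (forall V, L V -> L (set_add V H)) /\ H = \bigcap_(V in Lmax) V,
      [/\ L A, closed_in T A, A `<=` H & N = T -> A = H]
    & linear_on T gamma <-> H = T].
Proof.
move=> N L Lmax H A; split.
- by move=> w v Hw Nv; exact: span2_core.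
- by split; [exact: linear_subspace_core|exact: closed_core|
             exact: core_linearity].
- split; first by move=> V LV; exact: linearity_subspace_add_core.
  exact: core_bigcap_maximal.
- by split; [exact: additivity_linearity|exact: closed_additivity_space|
             exact: additivity_sub_core|exact: additivity_core_odd].
- exact: linear_on_core.
Qed.
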